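(* For the $T^2$-action on the nearly Kähler six-sphere with multi-moment map $\nu_{\mathbb{S}^6}$ described in the context, there are three two-dimensional spheres in $\mathbb{S}^6$ where $\nu_{\mathbb{S}^6}$ and $d\nu_{\mathbb{S}^6}$ vanish. These three spheres intersect at two common points. Further, there are two $T^2$-orbits of critical points where $\nu_{\mathbb{S}^6}$ attains its extrema.
   Context: On $\mathbb{R}^7$ with coordinates $x^1,\dots,x^7$, standard inner product and standard dual basis $e^1,\dots,e^7$, let $\varphi = e^{123}+e^{145}+e^{167}+e^{246}-e^{257}-e^{347}-e^{356}$, where $e^{ijk}=e^i\wedge e^j\wedge e^k$. The cross product $P$ is defined by $\langle P(X,Y),Z\rangle=\varphi(X,Y,Z)$. On $\mathbb{S}^6\subset\mathbb{R}^7$ with round metric $g$ and unit normal $N$ put $JX = P(N,X)$, $\sigma = g(J\cdot,\cdot)$, $\psi_+=\iota^*\varphi$, $\psi_-=-\iota^*(N\lrcorner{*}\varphi)$, where $\iota:\mathbb{S}^6\hookrightarrow\mathbb{R}^7$ is the inclusion and $*$ is the Hodge star operator on $\mathbb{R}^7$ determined by the inner product and orientation induced by $\varphi$; this is a nearly Kähler structure ($d\sigma=3\psi_+$, $d\psi_-=-2\sigma\wedge\sigma$). Identify $\mathbb{R}^7\cong\mathbb{C}^3\oplus\mathbb{R}$ by $z^1=x^1+ix^6$, $z^2=x^5+ix^2$, $z^3=x^4+ix^3$, $t=x^7$. The torus $T^2$ of matrices $\mathrm{diag}(e^{i\vartheta},e^{i\phi},e^{-i(\vartheta+\phi)})$ in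 $\mathrm{SU}(3)$ acts on $\mathbb{S}^6$ by $(z^1,z^2,z^3,t)\mapsto(e^{i\vartheta}z^1,e^{i\phi}z^2,e^{-i(\vartheta+\phi)}z^3,t)$, preserving the structure. Let $U,V$ be the vector fields generated by $\vartheta$ and $\phi$ respectively. The multi-moment map is $\nu_{\mathbb{S}^6}=\sigma(U,V)$, which equals $3\,\mathrm{Re}(z^1z^2z^3)$ and satisfies $d\nu_{\mathbb{S}^6}=3\psi_+(U,V,\cdot)$. *)

(* Defs.v *)
From HB Require Import structures.
From mathcomp Require Import all_boot all_order all_algebra.
From mathcomp Require Import complex.
From mathcomp Require Import all_classical all_reals all_analysis.
Import numFieldNormedType.Exports.
Import Order.TTheory GRing.Theory Num.Theory.

Set Implicit Arguments.
Unset Strict Implicit.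
Unset Printing Implicit Defensive.

Local Open Scope classical_set_scope.
Local Open Scope ring_scope.

Section Euclidean.
Context {R : realType}.

(* The library norm on row vectors is the sup norm, so the Euclidean
   structure is defined here; both give the same topology. *)
Definition dot {n : nat} (x y : 'rV[R]_n) : R := \sum_i x 0 i * y 0 i.

Definition unit_sphere {n : nat} : set 'rV[R]_n := [set x | dot x x = 1].

(* Round k-spheres in R^n: images of the unit sphere of R^(k+1) under a linear
   isometric embedding, scaled and translated.  The rows of B are orthonormal. *)
Definition is_sphere (k n : nat) (A : set 'rV[R]_n) : Prop :=
  exists (c : 'rV[R]_n) (r : R) (B : 'M[R]_(k.+1, n)),
    [/\ 0 < r, B *m B^T = 1%:M
      & A = [set c + r *: (y *m B) | y in @unit_sphere k.+1]].

End Euclidean.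

Section G2.
Context {R : realType}.
Implicit Types (p x X Y Z v : 'rV[R]_7).

(* Coordinates are numbered 1, ..., 7 as in x^1, ..., x^7. *)
Definition coord7 (k : nat) (x : 'rV[R]_7) : R := x 0 (inord k.-1).

Definition e3 (i j k : nat) X Y Z : R :=
  \det (\matrix_(a < 3, b < 3)
          coord7 (nth 0%N [:: i; j; k] b) (nth 0 [:: X; Y; Z] a)).

Definition varphi X Y Z : R :=
  e3 1 2 3 X Y Z + e3 1 4 5 X Y Z + e3 1 6 7 X Y Z + e3 2 4 6 X Y Z
  - e3 2 5 7 X Y Z - e3 3 4 7 X Y Z - e3 3 5 6 X Y Z.

(* The vector such that dot (cross X Y) Z = varphi X Y Z for all Z. *)
Definition cross X Y : 'rV[R]_7 := \row_i varphi X Y (delta_mx 0 i).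

Definition S6 : set 'rV[R]_7 := @unit_sphere R 7.

Definition tangent p v : Prop := dot p v = 0.

Definition unit_normal p : 'rV[R]_7 := p.

Definition J p X : 'rV[R]_7 := cross (unit_normal p) X.

Definition sigma p X Y : R := dot (J p X) Y.

Definition radial_proj x : 'rV[R]_7 := (Num.sqrt (dot x x))^-1 *: x.

(* The differential at p in S^6, on a tangent vector v, of the restriction
   of f to S^6: f o radial_proj extends that restriction to R^7 \ {0} and
   is smooth when f is, so its directional derivatives exist. *)
Definition dS6 (f : 'rV[R]_7 -> R) p v : R := 'D_v (f \o radial_proj) p.

End G2.

Section TorusAction.
Context {R : realType}.
Implicit Types (p x : 'rV[R]_7) (theta phi : R).

Definition z1 x : R[i] := Complex (coord7 1 x) (coord7 6 x).
Definition z2 x : R[i] := Complex (coord7 5 x) (coord7 2 x).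
Definition z3 x : R[i] := Complex (coord7 4 x) (coord7 3 x).
Definition tcoord x : R := coord7 7 x.

(* Inverse of x |-> (z1 x, z2 x, z3 x, tcoord x). *)
Definition of_C3R (w1 w2 w3 : R[i]) (t : R) : 'rV[R]_7 :=
  \row_(i < 7) nth 0 [:: complex.Re w1; complex.Im w2; complex.Im w3;
                         complex.Re w3; complex.Re w2; complex.Im w1; t] i.

Definition expi (a : R) : R[i] := Complex (cos a) (sin a).

Definition torus_act theta phi x : 'rV[R]_7 :=
  of_C3R (expi theta * z1 x) (expi phi * z2 x)
         (expi (- (theta + phi)) * z3 x) (tcoord x).

Definition torus_orbit p : set 'rV[R]_7 :=
  [set x | exists theta phi, x = torus_act theta phi p].

Definition U p : 'rV[R]_7 :=
  derive1 (fun theta : R => torus_act theta 0 p) 0.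
Definition V p : 'rV[R]_7 :=
  derive1 (fun phi : R => torus_act 0 phi p) 0.

Definition nu p : R := sigma p (U p) (V p).

Definition critical p : Prop := forall v, tangent p v -> dS6 nu p v = 0.

End TorusAction.

(* Main.v *)
Require Import Defs.
From HB Require Import structures.
From mathcomp Require Import all_boot all_order all_algebra.
From mathcomp Require Import complex.
From mathcomp Require Import all_classical all_reals all_analysis.
From mathcomp Require Import ring lra.
Import numFieldNormedType.Exports.
Import Order.TTheory GRing.Theory Num.Theory.
Local Open Scope classical_set_scope.
Local Open Scope ring_scope.

(** In the complex coordinates nu = 3 Re (z1 z2 z3), a homogeneous cubic.  Hence
    at p in S^6 the differential of nu on a tangent vector v is <grad nu, v>,
    and <p, grad nu> = 3 nu.  If nu p = 0 the gradient is itself tangent, so p is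
    critical iff grad nu = 0, i.e. iff all products z_i z_j (i <> j) vanish, i.e.
    iff at most one z_i is nonzero; this gives three 2-spheres through the poles
    t = 1 and t = -1.  The inequality of arithmetic and geometric means applied
    to the |z_i|^2, of sum at most 1, gives nu^2 <= 9 |z1 z2 z3|^2 <= 1/3, with
    equality iff |z_i|^2 = 1/3, t = 0 and Im (z1 z2 z3) = 0; fixing the sign of
    nu leaves a single torus orbit. *)

Section MultiMomentMapS6.
Context {R : realType}.
Implicit Types (p x y v X Y Z : 'rV[R]_7).

(** * Real coordinates and the form [sigma] *)

Lemma sum_ord7 (F : 'I_7 -> R) : \sum_i F i =
  F (inord 0) + F (inord 1) + F (inord 2) + F (inord 3) + F (inord 4)
  + F (inord 5) + F (inord 6).
Proof.
rewrite !big_ord_recr big_ord0 /= add0r.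
by do !congr (_ + _); congr F; apply/val_inj; rewrite /= inordK.
Qed.

Lemma dotE x y : dot x y =
  coord7 1 x * coord7 1 y + coord7 2 x * coord7 2 y + coord7 3 x * coord7 3 y
  + coord7 4 x * coord7 4 y + coord7 5 x * coord7 5 y + coord7 6 x * coord7 6 y
  + coord7 7 x * coord7 7 y.
Proof. by rewrite /dot sum_ord7. Qed.

Lemma e3E i j k X Y Z : e3 i j k X Y Z =
  coord7 i X * (coord7 j Y * coord7 k Z - coord7 k Y * coord7 j Z)
  - coord7 j X * (coord7 i Y * coord7 k Z - coord7 k Y * coord7 i Z)
  + coord7 k X * (coord7 i Y * coord7 j Z - coord7 j Y * coord7 i Z).
Proof.
rewrite /e3 (expand_det_row _ 0) !big_ord_recl big_ord0 /cofactor.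
rewrite !(expand_det_row _ 0) !big_ord_recl !big_ord0 /cofactor !det_mx11.
rewrite !mxE /= /bump /= !addn0 !expr0 !expr1 ?exprS ?expr0.
ring.
Qed.

Lemma coord7_delta k l : (0 < k <= 7)%N -> (0 < l <= 7)%N ->
  coord7 k (delta_mx 0 (inord l.-1) : 'rV[R]_7) = (k == l)%:R.
Proof.
case: k l => [|k] [|l] //= kl ll; rewrite /coord7 mxE eqxx /=.
by rewrite -(inj_eq val_inj) /= !inordK.
Qed.

(** [J p X] has the coordinates [varphi p X e_i], so pairing it with [Y] reassembles [varphi p X Y]
    by linearity in the third argument. *)
Lemma sigmaE p X Y : sigma p X Y = varphi p X Y.
Proof.
rewrite /sigma dotE /J /cross /unit_normal.
rewrite ![coord7 _ (\row_i _)]mxE /varphi !e3E.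
rewrite !(@coord7_delta _ 1, @coord7_delta _ 2, @coord7_delta _ 3,
  @coord7_delta _ 4, @coord7_delta _ 5, @coord7_delta _ 6,
  @coord7_delta _ 7) //=.
ring.
Qed.

(** * The generating vector fields and the formula for [nu] *)

Lemma derive1_row n (f : R -> 'rV[R]_n) (x : R) (df : 'rV[R]_n) :
  (forall j, is_derive x 1 (fun t => f t 0 j) (df 0 j)) -> derive1 f x = df.
Proof.
move=> h; rewrite derive1E derive_mx; last first.
  apply/derivable_mxP => i j; rewrite (ord1 i).
  exact: (@ex_derive _ _ _ _ _ _ _ (h j)).
by apply/rowP => j; rewrite mxE; exact: (@derive_val _ _ _ _ _ _ _ (h j)).
Qed.

(** Moving one angle of the torus splits a point into a rotating part and a fixed part [C]; [B] is
    the rotating part [A] after a quarter turn, hence the velocity at time 0. *)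
Lemma derive1_trig n (f : R -> 'rV[R]_n) A B C :
  (forall t, f t = cos t *: A + sin t *: B + C) -> derive1 f 0 = B.
Proof.
move=> fE; apply: derive1_row => j.
have -> : (fun t => f t 0 j) =
    cos * cst (A 0 j) + sin * cst (B 0 j) + cst (C 0 j).
  by apply/funext => t; rewrite fE !mxE.
apply: is_derive_eq.
rewrite /= cos0 sin0 /GRing.scale /= /cst; ring.
Qed.

(** A product in [Type] instead of a conjunction lets [rewrite] use the seven equations as one
    multirule. *)
Lemma coord7_of_C3R w1 w2 w3 (t : R) :
  ((coord7 1 (of_C3R w1 w2 w3 t) = complex.Re w1)
  * (coord7 2 (of_C3R w1 w2 w3 t) = complex.Im w2)
  * (coord7 3 (of_C3R w1 w2 w3 t) = complex.Im w3)
  * (coord7 4 (of_C3R w1 w2 w3 t) = complex.Re w3)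
  * (coord7 5 (of_C3R w1 w2 w3 t) = complex.Re w2)
  * (coord7 6 (of_C3R w1 w2 w3 t) = complex.Im w1)
  * (coord7 7 (of_C3R w1 w2 w3 t) = t))%type.
Proof. by rewrite /coord7 !mxE !inordK. Qed.

Lemma coord7P x y :
  (forall k, (0 < k <= 7)%N -> coord7 k x = coord7 k y) -> x = y.
Proof.
move=> xy; apply/rowP => i; have := xy i.+1 (ltn_ord i).
by rewrite /coord7 /= inord_val.
Qed.

Lemma UE p : U p = of_C3R ('i * z1 p) 0 (- ('i * z3 p)) 0.
Proof.
apply: (derive1_trig _ _ (of_C3R (z1 p) 0 (z3 p) 0) _
  (of_C3R 0 (z2 p) 0 (tcoord p))).
move=> t; apply/rowP; case; do 7?[case=> [?|]] => //;
  rewrite !mxE /= ?addr0 ?cosN ?sinN ?cos0 ?sin0; ring.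
Qed.

Lemma VE p : V p = of_C3R 0 ('i * z2 p) (- ('i * z3 p)) 0.
Proof.
apply: (derive1_trig _ _ (of_C3R 0 (z2 p) (z3 p) 0) _
  (of_C3R (z1 p) 0 0 (tcoord p))).
move=> t; apply/rowP; case; do 7?[case=> [?|]] => //;
  rewrite !mxE /= ?add0r ?cosN ?sinN ?cos0 ?sin0; ring.
Qed.

(** The right-hand side is 3 Re (z1 z2 z3) written out in real coordinates. *)
Lemma nuE p : nu p =
  3 * (coord7 1 p * (coord7 5 p * coord7 4 p - coord7 2 p * coord7 3 p)
       - coord7 6 p * (coord7 2 p * coord7 4 p + coord7 5 p * coord7 3 p)).
Proof.
rewrite /nu sigmaE UE VE /varphi !e3E.
rewrite !coord7_of_C3R /=; ring.
Qed.

(** * The gradient of [nu] and its differential on the sphere *)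

Lemma coord7D k x y : coord7 k (x + y) = coord7 k x + coord7 k y.
Proof. by rewrite /coord7 mxE. Qed.

Lemma coord7N k x : coord7 k (- x) = - coord7 k x.
Proof. by rewrite /coord7 mxE. Qed.

Lemma coord7Z k (a : R) x : coord7 k (a *: x) = a * coord7 k x.
Proof. by rewrite /coord7 mxE. Qed.

(** Euclidean gradient of 3 Re (z1 z2 z3): since the real inner product on C is Re (conj w * z), the
    component along z1 is 3 conj (z2 z3), and likewise for z2 and z3. *)
Definition grad_nu p : 'rV[R]_7 :=
  3 *: of_C3R (conjc (z2 p * z3 p)) (conjc (z1 p * z3 p))
         (conjc (z1 p * z2 p)) 0.

Lemma nuZ (a : R) x : nu (a *: x) = a ^+ 3 * nu x.
Proof. rewrite !nuE !coord7Z; ring. Qed.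

(** The Taylor expansion of a cubic form is exact, and by symmetry of its polarisation the
    coefficient of [h ^+ 2] is the gradient at [v] paired with [p]. *)
Lemma nu_line p v (h : R) : nu (h *: v + p) =
  nu p + h * dot (grad_nu p) v + h ^+ 2 * dot (grad_nu v) p + h ^+ 3 * nu v.
Proof.
rewrite !nuE !dotE /grad_nu !coord7Z !coord7D !coord7Z !coord7_of_C3R /=; ring.
Qed.

(** Euler's identity for a form of degree 3. *)
Lemma dot_grad_nu p : dot p (grad_nu p) = 3 * nu p.
Proof. rewrite dotE nuE /grad_nu !coord7Z !coord7_of_C3R /=; ring. Qed.

Lemma dot_line p v (h : R) : S6 p -> tangent p v ->
  dot (h *: v + p) (h *: v + p) = 1 + h ^+ 2 * dot v v.
Proof.
rewrite /S6 /unit_sphere /tangent /= => <- pv0.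
transitivity (dot p p + h ^+ 2 * dot v v + 2 * h * dot p v);
  last by rewrite pv0; ring.
rewrite !dotE !coord7D !coord7Z; ring.
Qed.

(** Both sides are limits of the same difference quotient; this brings the differential on the
    sphere down to calculus in one real variable. *)
Lemma derive_along_line (W : normedModType R) (f : W -> R) (p v : W) :
  'D_v f p = 'D_1 (fun h : R => f (h *: v + p)) 0.
Proof.
have E : (fun h : R => h^-1 *: ((f \o shift p) (h *: v) - f p)) =
    (fun h : R => h^-1 *:
      (((fun k : R => f (k *: v + p)) \o shift 0) (h *: (1 : R))
      - f (0 *: v + p))).
  by apply/funext => h /=; rewrite addr0 scale0r add0r [h *: 1]mulr1.
exact: (congr1 (fun g : R -> R => lim (g @ 0^')) E).
Qed.

Lemma is_derive_cubic (a b c d : R) :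
  is_derive (0 : R) 1 (fun h : R => a + h * b + h ^+ 2 * c + h ^+ 3 * d) b.
Proof.
have -> : (fun h : R => a + h * b + h ^+ 2 * c + h ^+ 3 * d) =
    horner (Poly [:: a; b; c; d]).
  by apply/funext => h; rewrite horner_Poly /=; ring.
apply: (is_derive_eq (is_derive_poly _ _)).
by rewrite horner_coef0 coef_deriv coef_Poly.
Qed.

(* On the line p + h v with v tangent, the normalising factor |p + h v|^-3 only
   involves h^2, so it does not contribute to the derivative at h = 0. *)
Lemma dS6_nu p v : S6 p -> tangent p v -> dS6 nu p v = dot (grad_nu p) v.
Proof.
move=> Sp pv; rewrite /dS6 derive_along_line.
(* The vanishing terms give the squared norm along the line the shape required by
   [is_derive_cubic]. *)
pose q (h : R) := 1 + h * 0 + h ^+ 2 * dot v v + h ^+ 3 * 0.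
pose r (h : R) := nu p + h * dot (grad_nu p) v + h ^+ 2 * dot (grad_nu v) p
  + h ^+ 3 * nu v.
have q0 : q 0 = 1 by rewrite /q; ring.
have -> : (fun h : R => (nu \o radial_proj) (h *: v + p)) =
    (fun h => ((Num.sqrt \o q) h)^-1) ^+ 3 * r.
  apply/funext => h /=; rewrite /radial_proj nuZ dot_line// nu_line.
  by rewrite !fctE /q !mulr0 !addr0.
have dq : is_derive (0 : R) 1 q 0 by exact: is_derive_cubic.
have dr : is_derive (0 : R) 1 r (dot (grad_nu p) v) by exact: is_derive_cubic.
have dsq : is_derive (0 : R) 1 (Num.sqrt \o q) 0.
  apply: (is_derive_eq (is_derive1_comp (is_derive1_sqrt _) dq)).
    by rewrite q0.
  by rewrite mulr0.
have dV : is_derive (0 : R) 1 (fun h => ((Num.sqrt \o q) h)^-1) 0.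
  apply: (is_derive_eq (is_deriveV _ dsq)); last by rewrite scaler0.
  by rewrite /= q0 sqrtr1 oner_eq0.
rewrite (@derive_val _ _ _ _ _ _ _ (is_deriveM (is_deriveX 3 dV) dr)).
by rewrite /GRing.scale /= !fctE q0 sqrtr1 invr1 expr1n mul1r !mulr0 addr0.
Qed.

(** * Critical points on the zero level *)

Lemma dot_eq0 n (x : 'rV[R]_n) : dot x x = 0 -> x = 0.
Proof.
move=> /eqP; rewrite /dot psumr_eq0 => [/allP x0|i _]; last exact: sqr_ge0.
apply/rowP => j; rewrite mxE; apply/eqP.
by rewrite -sqrf_eq0 expr2; apply: (implyP (x0 j _)); rewrite ?mem_index_enum.
Qed.

Lemma grad_nu_eq0 p : grad_nu p = 0 ->
  [/\ z2 p * z3 p = 0, z1 p * z3 p = 0 & z1 p * z2 p = 0].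
Proof.
move=> /eqP; rewrite scaler_eq0 pnatr_eq0 /= => /eqP g0.
have c k : coord7 k (of_C3R (conjc (z2 p * z3 p)) (conjc (z1 p * z3 p))
                       (conjc (z1 p * z2 p)) 0) = 0.
  by rewrite g0 /coord7 mxE.
move: (c 1%N) (c 2%N) (c 3%N) (c 4%N) (c 5%N) (c 6%N); rewrite !coord7_of_C3R.
have conj0 (z : R[i]) :
    complex.Re (conjc z) = 0 -> complex.Im (conjc z) = 0 -> z = 0.
  by case: z => a b /= -> /eqP; rewrite oppr_eq0 => /eqP ->.
by move=> *; split; apply: conj0.
Qed.

(** The index counts from 0: index 0 stands for z1. *)
Definition zcoord (i : 'I_3) x : R[i] := nth 0 [:: z1 x; z2 x; z3 x] i.

Lemma zcoord_prod_eq0 x :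
  [/\ z2 x * z3 x = 0, z1 x * z3 x = 0 & z1 x * z2 x = 0] <->
  exists i, forall j, j <> i -> zcoord j x = 0.
Proof.
split=> [[/eqP + /eqP + /eqP]|[i zi]].
  rewrite !mulf_eq0 /zcoord.
  (* Four sign patterns survive, in this order: all three vanish, where index 0 is an arbitrary
     choice, or exactly one of z3, z2, z1 is nonzero and gives the index. *)
  have [a|a] := eqVneq (z1 x) 0; have [b|b] := eqVneq (z2 x) 0;
    have [c|c] := eqVneq (z3 x) 0 => //= _ _ _;
   [exists (inord 0)|exists (inord 2)|exists (inord 1)|exists (inord 0)];
   by case=> [[|[|[|//]]] ?] //= ne; case: ne; apply/val_inj; rewrite /= inordK.
have z (j : nat) : (j < 3)%N -> j != i -> nth 0 [:: z1 x; z2 x; z3 x] j = 0.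
  by move=> j3 ji; apply: (zi (Ordinal j3)) => e; rewrite -e eqxx in ji.
case: i {zi} z => [[|[|[|//]]] ?] z.
- have /= e2 := z 1%N isT isT; have /= e3 := z 2%N isT isT.
  by rewrite e2 e3 !(mulr0, mul0r).
- have /= e1 := z 0%N isT isT; have /= e3 := z 2%N isT isT.
  by rewrite e1 e3 !(mulr0, mul0r).
- have /= e1 := z 0%N isT isT; have /= e2 := z 1%N isT isT.
  by rewrite e1 e2 !(mulr0, mul0r).
Qed.

Lemma nu_critical0 p : S6 p ->
  (nu p = 0 /\ critical p) <-> exists i, forall j, j <> i -> zcoord j p = 0.
Proof.
move=> Sp; split=> [[nu0 cr]|/zcoord_prod_eq0[e1 e2 e3]].
  apply/zcoord_prod_eq0/grad_nu_eq0/dot_eq0.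
  (* On the zero level the gradient is tangent, so criticality may be tested on the gradient itself;
     this makes its squared length zero. *)
  have gp : tangent p (grad_nu p) by rewrite /tangent dot_grad_nu nu0 mulr0.
  by rewrite -dS6_nu// cr.
have g0 : grad_nu p = 0.
  rewrite /grad_nu e1 e2 e3 (_ : of_C3R _ _ _ _ = 0) ?scaler0//.
  by apply/rowP; case; do 7?[case=> [?|]] => //; rewrite !mxE /= ?oppr0.
split.
  (* With zero gradient, Euler's identity leaves 3 nu = 0. *)
  by have := dot_grad_nu p; rewrite g0 /dot big1 => [|i _];
    [lra|rewrite mxE mulr0].
by move=> v pv; rewrite dS6_nu// g0 /dot big1// => i _; rewrite mxE mul0r.
Qed.

(** * The three coordinate two-spheres *)

Lemma dot_mulmx n (x y : 'rV[R]_n) : dot x y = (x *m y^T) 0 0.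
Proof. by rewrite mxE; apply: eq_bigr => i _; rewrite mxE. Qed.

(** The set is the unit sphere of the subspace spanned by the basis vectors with index in the image
    of [f]. These vectors are the rows of [B], orthonormal because [f] is injective; the centre is 0
    and the radius 1. *)
Lemma is_sphere_coord k n (f : 'I_k.+1 -> 'I_n) : injective f ->
  is_sphere k [set x : 'rV[R]_n |
    dot x x = 1 /\ forall j, j \notin codom f -> x 0 j = 0].
Proof.
move=> finj; pose B : 'M[R]_(k.+1, n) := \matrix_(a, b) (f a == b)%:R.
have BB : B *m B^T = 1%:M.
  apply/matrixP => a b; rewrite !mxE (bigD1 (f a))//= big1 => [|j ja].
    by rewrite !mxE eqxx mul1r addr0 (inj_eq finj) eq_sym.
  by rewrite !mxE eq_sym (negPf ja) mul0r.
have yB (y : 'rV[R]_k.+1) : dot (y *m B) (y *m B) = dot y y.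
  by rewrite !dot_mulmx trmx_mul mulmxA -(mulmxA y) BB mulmx1.
exists 0, 1, B; split=> //; apply/seteqP; split=> x /=.
  move=> [x1 x0]; have xE : (\row_a x 0 (f a)) *m B = x.
    apply/rowP => j; rewrite mxE; have [/codomP[a ->]|jf] := boolP (j \in codom f).
      rewrite (bigD1 a)//= big1 => [|b ba].
        by rewrite !mxE eqxx mulr1 addr0.
      by rewrite !mxE (inj_eq finj) (negPf ba) mulr0.
    rewrite x0// big1// => a _; rewrite !mxE [f a == j](_ : _ = false) ?mulr0//.
    by apply: contraNF jf => /eqP <-; exact: codom_f.
  exists (\row_a x 0 (f a)); last by rewrite scale1r add0r xE.
  by rewrite /unit_sphere /= -yB xE.
move=> [y y1 <-]; rewrite scale1r add0r yB; split=> // j jf.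
rewrite mxE big1// => a _; rewrite !mxE [f a == j](_ : _ = false) ?mulr0//.
by apply: contraNF jf => /eqP <-; exact: codom_f.
Qed.

(** Unit sphere of the real 3-space formed by the i-th complex line and the t-axis. *)
Definition nu_sphere (i : 'I_3) : set 'rV[R]_7 :=
  [set x | S6 x /\ forall j, j <> i -> zcoord j x = 0].

(* Positions, counted from 0, of Re z_i, Im z_i and t among the 7 coordinates. *)
Definition axis_indices (i : 'I_3) : seq nat :=
  nth [::] [:: [:: 0; 5; 6]; [:: 4; 1; 6]; [:: 3; 2; 6]]%N i.

Definition sphere_axes (i a : 'I_3) : 'I_7 := inord (nth 0%N (axis_indices i) a).

Lemma val_sphere_axes i a : sphere_axes i a = nth 0%N (axis_indices i) a :> nat.
Proof.
by rewrite inordK//; case: i a => [[|[|[|//]]] ?] [[|[|[|//]]] ?].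
Qed.

Lemma sphere_axes_inj i : injective (sphere_axes i).
Proof.
move=> a b /(congr1 val) /=; rewrite !val_sphere_axes => ab.
apply/val_inj; move: ab.
by case: i a b => [[|[|[|//]]] ?] [[|[|[|//]]] ?] [[|[|[|//]]] ?].
Qed.

Lemma mem_codom_sphere_axes i (j : 'I_7) :
  (j \in codom (sphere_axes i)) = (nat_of_ord j \in axis_indices i).
Proof.
have si : size (axis_indices i) = 3 by case: i => [[|[|[|//]]] ?].
apply/codomP/idP => [[a ->]|].
  by rewrite val_sphere_axes mem_nth// si.
move=> /(nthP 0%N)[a]; rewrite si => a3 e; exists (Ordinal a3).
by apply/val_inj; rewrite /= val_sphere_axes e.
Qed.

(** The two complex coordinates other than z_i fill exactly the four real positions outside
    [axis_indices i]; this puts the set in the form treated by [is_sphere_coord]. *)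
Lemma nu_sphereE i : nu_sphere i =
  [set x | dot x x = 1 /\ forall j, j \notin codom (sphere_axes i) -> x 0 j = 0].
Proof.
apply/seteqP; split=> x /= [x1 x0]; split=> //.
  have z (j : nat) : (j < 3)%N -> j != i ->
      complex.Re (nth 0 [:: z1 x; z2 x; z3 x] j) = 0 /\
      complex.Im (nth 0 [:: z1 x; z2 x; z3 x] j) = 0.
    move=> j3 ji; have /= := x0 (Ordinal j3); rewrite /zcoord /= => ->//.
    by move=> e; rewrite -e eqxx in ji.
  move=> j; rewrite mem_codom_sphere_axes.
  have -> : x 0 j = coord7 j.+1 x by rewrite /coord7 /= inord_val.
  case: i {x0} z => [[|[|[|//]]] ?] /= z.
  - have /= [? ?] := z 1%N isT isT; have /= [? ?] := z 2%N isT isT.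
    by case: j => [[|[|[|[|[|[|[|//]]]]]]] ?].
  - have /= [? ?] := z 0%N isT isT; have /= [? ?] := z 2%N isT isT.
    by case: j => [[|[|[|[|[|[|[|//]]]]]]] ?].
  - have /= [? ?] := z 0%N isT isT; have /= [? ?] := z 1%N isT isT.
    by case: j => [[|[|[|[|[|[|[|//]]]]]]] ?].
have c k : (k < 7)%N -> k \notin axis_indices i -> coord7 k.+1 x = 0.
  by move=> k7 ki; apply: x0; rewrite mem_codom_sphere_axes inordK.
move=> j ji; have {}ji : j != i by apply/eqP.
case: i j ji {x0} c => [[|[|[|//]]] ?] [[|[|[|//]]] ?] // _ c;
  by rewrite /zcoord /= /z1 /z2 /z3 !c.
Qed.

Lemma is_sphere_nu_sphere i : is_sphere 2 (nu_sphere i).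
Proof. rewrite nu_sphereE; exact/is_sphere_coord/sphere_axes_inj. Qed.

Lemma nu_sphere_inj : injective nu_sphere.
Proof.
move=> i j ij; apply: contrapT => ne.
(* The point with z_i = 1 and all else 0 lies on the i-th sphere and on neither of the others. *)
pose w : 'rV[R]_7 :=
  of_C3R (i == 0 :> nat)%:R (i == 1 :> nat)%:R (i == 2 :> nat)%:R 0.
have : nu_sphere i w.
  split.
    rewrite /S6 /unit_sphere /= dotE !coord7_of_C3R.
    by case: i {w ij ne} => [[|[|[|//]]] ?] /=; ring.
  move=> k ki; have {ki} : k != i by apply/eqP.
  rewrite /zcoord /z1 /z2 /z3 !coord7_of_C3R.
  by case: i k {w ij ne} => [[|[|[|//]]] ?] [[|[|[|//]]] ?].
rewrite ij => -[_ /(_ _ ne)] /eqP; apply/negP.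
rewrite /zcoord /z1 /z2 /z3 !coord7_of_C3R eq_complex.
by case: i {w ij ne} => [[|[|[|//]]] ?] /=; rewrite oner_eq0.
Qed.

(** * Poles and intersections of the spheres *)

Definition pole (t : R) : 'rV[R]_7 := of_C3R 0 0 0 t.

Lemma poleP x : S6 x -> (forall i, zcoord i x = 0) -> x = pole 1 \/ x = pole (-1).
Proof.
move=> Sx zx.
have [x1 x6] : coord7 1 x = 0 /\ coord7 6 x = 0.
  by have := zx (inord 0); rewrite /zcoord inordK//= => -[].
have [x5 x2] : coord7 5 x = 0 /\ coord7 2 x = 0.
  by have := zx (inord 1); rewrite /zcoord inordK//= => -[].
have [x4 x3] : coord7 4 x = 0 /\ coord7 3 x = 0.
  by have := zx (inord 2); rewrite /zcoord inordK//= => -[].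
have xE : x = pole (coord7 7 x).
  apply: coord7P.
  by case=> [//|[|[|[|[|[|[|[|//]]]]]]]] _; rewrite !coord7_of_C3R.
have /eqP : coord7 7 x ^+ 2 = 1.
  by move: Sx; rewrite /S6 /unit_sphere /= dotE x1 x2 x3 x4 x5 x6 => <-; ring.
by rewrite xE sqrf_eq1 coord7_of_C3R => /orP[] /eqP ->; [left|right].
Qed.

Lemma nu_sphere_pole i (t : R) : t ^+ 2 = 1 -> nu_sphere i (pole t).
Proof.
move=> t1; split=> [|k _].
  by rewrite /S6 /unit_sphere /= dotE !coord7_of_C3R -t1 /=; ring.
rewrite /zcoord /z1 /z2 /z3 !coord7_of_C3R.
by case: k => [[|[|[|//]]] ?].
Qed.

(** Every index differs from [i] or from [j], so all three z_k vanish on the intersection and only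
    the t-axis remains. *)
Lemma nu_sphere_cap i j : i <> j ->
  nu_sphere i `&` nu_sphere j = [set pole 1; pole (-1)].
Proof.
move=> ij; apply/seteqP; split=> x /=.
  move=> [[Sx xi] [_ xj]]; apply: poleP => // k.
  by have [e|/eqP] := eqVneq k i; [apply: xj; rewrite e|exact: xi].
by move=> [] ->; split; apply: nu_sphere_pole; rewrite ?sqrrN expr1n.
Qed.

(** * The sharp bound on [nu] and the case of equality *)

(* zsq1, zsq2, zsq3 are the |z_i|^2 and Im_prod is Im (z1 z2 z3). *)
Definition zsq1 x : R := coord7 1 x ^+ 2 + coord7 6 x ^+ 2.
Definition zsq2 x : R := coord7 2 x ^+ 2 + coord7 5 x ^+ 2.
Definition zsq3 x : R := coord7 3 x ^+ 2 + coord7 4 x ^+ 2.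

(** The difference (a + b + c)^3 - 27abc is a combination with positive coefficients of the six
    nonnegative products supplied to [nra]. *)
Lemma amgm3_le (a b c : R) : 0 <= a -> 0 <= b -> 0 <= c -> a + b + c <= 1 ->
  27 * (a * b * c) <= 1.
Proof.
move=> a0 b0 c0 s1.
have s0 : 0 <= a + b + c by lra.
have : (a + b + c) ^+ 3 <= 1 by rewrite exprn_ile1.
have := mulr_ge0 s0 (sqr_ge0 (a - b)).
have := mulr_ge0 s0 (sqr_ge0 (b - c)).
have := mulr_ge0 s0 (sqr_ge0 (a - c)).
have := mulr_ge0 a0 (sqr_ge0 (b - c)).
have := mulr_ge0 b0 (sqr_ge0 (a - c)).
have := mulr_ge0 c0 (sqr_ge0 (a - b)).
nra.
Qed.

Lemma amgm3_eq (a b c : R) : 0 <= a -> 0 <= b -> 0 <= c -> a + b + c <= 1 ->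
  1 <= 27 * (a * b * c) -> [/\ a = 3^-1, b = 3^-1 & c = 3^-1].
Proof.
move=> a0 b0 c0 s1 abc.
have s0 : 0 <= a + b + c by lra.
have s3 : (a + b + c) ^+ 3 <= 1 by rewrite exprn_ile1.
have P1 := mulr_ge0 s0 (sqr_ge0 (a - b)).
have P2 := mulr_ge0 s0 (sqr_ge0 (b - c)).
have P3 := mulr_ge0 s0 (sqr_ge0 (a - c)).
have P4 := mulr_ge0 a0 (sqr_ge0 (b - c)).
have P5 := mulr_ge0 b0 (sqr_ge0 (a - c)).
have P6 := mulr_ge0 c0 (sqr_ge0 (a - b)).
have E : (a + b + c) ^+ 3 = 27 * (a * b * c) + 2^-1 * ((a + b + c) * (a - b) ^+ 2
  + (a + b + c) * (b - c) ^+ 2 + (a + b + c) * (a - c) ^+ 2)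
  + 3 * (a * (b - c) ^+ 2 + b * (a - c) ^+ 2 + c * (a - b) ^+ 2) by field.
(* A sum below 1 has cube below 1, while [E] bounds the cube from below by 27abc, which is at least
   1. *)
have S1 : a + b + c = 1.
  apply/eqP; rewrite eq_le s1 /= leNgt; apply/negP => lt1.
  have : (a + b + c) ^+ 3 < 1 by rewrite exprn_ilt1.
  lra.
(* For sum 1, [E] forces the nonnegative remainder to be 0, and its first three terms are now plain
   squares. *)
have ab : (a - b) ^+ 2 = 0 by rewrite S1 in E P1 P2 P3 s3; lra.
have bc : (b - c) ^+ 2 = 0 by rewrite S1 in E P1 P2 P3 s3; lra.
move: ab bc => /eqP; rewrite sqrf_eq0 => /eqP ab /eqP; rewrite sqrf_eq0 => /eqP bc.
by split; lra.
Qed.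

(** The value 3 s^3 of [nu] when every z_i equals s = 1 / sqrt 3. *)
Definition max_nu : R := (Num.sqrt 3)^-1.
Local Notation s := max_nu.

Lemma max_nu_gt0 : 0 < s.
Proof. by rewrite invr_gt0 sqrtr_gt0. Qed.

Lemma max_nu_sqr : s ^+ 2 = 3^-1.
Proof. by rewrite exprVn sqr_sqrtr. Qed.

Definition Im_prod x : R :=
  coord7 1 x * (coord7 5 x * coord7 3 x + coord7 2 x * coord7 4 x)
  + coord7 6 x * (coord7 5 x * coord7 4 x - coord7 2 x * coord7 3 x).

(** This is 9 |z1 z2 z3|^2 split into real and imaginary parts. *)
Lemma nu_sqr x : nu x ^+ 2 + 9 * Im_prod x ^+ 2 = 9 * (zsq1 x * zsq2 x * zsq3 x).
Proof. rewrite nuE /Im_prod /zsq1 /zsq2 /zsq3; ring. Qed.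

Lemma zsq_ge0 x : [/\ 0 <= zsq1 x, 0 <= zsq2 x & 0 <= zsq3 x].
Proof. by split; rewrite addr_ge0// sqr_ge0. Qed.

Lemma zsq_sum x : S6 x -> zsq1 x + zsq2 x + zsq3 x + coord7 7 x ^+ 2 = 1.
Proof.
by rewrite /S6 /unit_sphere /= dotE => <-; rewrite /zsq1 /zsq2 /zsq3; ring.
Qed.

Lemma nu_le x : S6 x -> nu x <= s.
Proof.
move=> /zsq_sum Sx; have [a0 b0 c0] := zsq_ge0 x; have t0 := sqr_ge0 (coord7 7 x).
have s1 : zsq1 x + zsq2 x + zsq3 x <= 1 by lra.
have h := amgm3_le _ _ _ a0 b0 c0 s1.
have n2 : nu x ^+ 2 <= s ^+ 2.
  have := sqr_ge0 (Im_prod x); have := nu_sqr x; rewrite max_nu_sqr; lra.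
apply: le_trans (ler_norm _) _.
by rewrite -(ler_pXn2r (n:=2)) ?nnegrE ?(ltW max_nu_gt0)// real_normK// num_real.
Qed.

Lemma nu_extremal x : S6 x -> nu x ^+ 2 = 3^-1 ->
  [/\ zsq1 x = 3^-1, zsq2 x = 3^-1, zsq3 x = 3^-1, coord7 7 x = 0 & Im_prod x = 0].
Proof.
move=> /zsq_sum Sx n2; have [a0 b0 c0] := zsq_ge0 x; have t0 := sqr_ge0 (coord7 7 x).
have s1 : zsq1 x + zsq2 x + zsq3 x <= 1 by lra.
have i0 := sqr_ge0 (Im_prod x); have N := nu_sqr x.
have [|a b c] := amgm3_eq _ _ _ a0 b0 c0 s1; first lra.
split=> //; apply/eqP; rewrite -sqrf_eq0; apply/eqP; first lra.
by move: N; rewrite a b c n2; lra.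
Qed.

(** At such a point the gradient equals [(3 * nu x) *: x], which is normal to the sphere. *)
Lemma nu_extremal_critical x : S6 x -> nu x ^+ 2 = 3^-1 -> critical x.
Proof.
move=> Sx n2; have [a b c _ _] := nu_extremal _ Sx n2.
have g : grad_nu x - (3 * nu x) *: x = 0.
  apply: dot_eq0.
  (* The squared length of the difference is expanded; Euler's identity turns the mixed term into a
     multiple of nu^2. At |z_i|^2 = nu^2 = 1/3 it equals 3 - 3. *)
  transitivity (9 * (zsq1 x * zsq2 x + zsq1 x * zsq3 x + zsq2 x * zsq3 x)
   - 9 * nu x ^+ 2 * (2 - dot x x)).
    rewrite nuE !dotE /grad_nu !coord7D !coord7N !coord7Z !coord7_of_C3R /=.
    by rewrite /zsq1 /zsq2 /zsq3; ring.
  rewrite a b c n2 (_ : dot x x = 1)//; lra.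
move=> v xv; rewrite dS6_nu// (subr0_eq g).
have : dot ((3 * nu x) *: x) v = 3 * nu x * dot x v.
  rewrite !dotE !coord7Z; ring.
by rewrite xv mulr0.
Qed.

(** * The two extremal torus orbits *)

Lemma circle_param (a b : R) :
  a ^+ 2 + b ^+ 2 = 1 -> exists t, a = cos t /\ b = sin t.
Proof.
move=> ab; have a1 : -1 <= a <= 1.
  rewrite -ler_norml -(ler_pXn2r (n:=2)) ?nnegrE// expr1n real_normK ?num_real//.
  by have := sqr_ge0 b; lra.
have ca : cos (acos a) = a by apply: acosK; rewrite in_itv.
have sa : sin (acos a) = `|b| by rewrite sin_acos// -sqrtr_sqr; congr Num.sqrt; lra.
(* The arc cosine fixes the angle up to sign; the sign of [b] decides. *)
have [b0|b0] := leP 0 b.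
  by exists (acos a); rewrite ca sa ger0_norm.
by exists (- acos a); rewrite cosN sinN ca sa ltr0_norm// opprK.
Qed.

Definition max_point : 'rV[R]_7 :=
  of_C3R (Complex s 0) (Complex s 0) (Complex s 0) 0.

Lemma coord7_torus_act (theta phi : R) x :
  ((coord7 1 (torus_act theta phi x) =
       cos theta * coord7 1 x - sin theta * coord7 6 x)%R
  * (coord7 6 (torus_act theta phi x) =
       cos theta * coord7 6 x + sin theta * coord7 1 x)%R
  * (coord7 5 (torus_act theta phi x) =
       cos phi * coord7 5 x - sin phi * coord7 2 x)%R
  * (coord7 2 (torus_act theta phi x) =
       cos phi * coord7 2 x + sin phi * coord7 5 x)%R
  * (coord7 4 (torus_act theta phi x) =
       cos (theta + phi) * coord7 4 x + sin (theta + phi) * coord7 3 x)%R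
  * (coord7 3 (torus_act theta phi x) =
       cos (theta + phi) * coord7 3 x - sin (theta + phi) * coord7 4 x)%R
  * (coord7 7 (torus_act theta phi x) = coord7 7 x)%R)%type.
Proof.
rewrite /torus_act !coord7_of_C3R /= cosN sinN /tcoord.
by do !split => //; ring.
Qed.

Lemma torus_orbit_max : torus_orbit max_point = [set x | S6 x /\ nu x = s].
Proof.
apply/seteqP; split=> x /=.
  move=> [theta [phi ->]]; rewrite /S6 /unit_sphere /= dotE nuE.
  rewrite !coord7_torus_act !coord7_of_C3R /=.
  have h1 := cos2Dsin2 theta; have h2 := cos2Dsin2 phi.
  have h3 := cos2Dsin2 (theta + phi).
  split.
    transitivity (s ^+ 2 * ((cos theta ^+ 2 + sin theta ^+ 2)
      + (cos phi ^+ 2 + sin phi ^+ 2)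
      + (cos (theta + phi) ^+ 2 + sin (theta + phi) ^+ 2))); first by ring.
    by rewrite h1 h2 h3 max_nu_sqr; field.
  transitivity (3 * s ^+ 2 * s *
    ((cos theta ^+ 2 + sin theta ^+ 2) * (cos phi ^+ 2 + sin phi ^+ 2))).
    rewrite cosD sinD; ring.
  by rewrite h1 h2 max_nu_sqr; field.
move=> [Sx ns]; have n2 : nu x ^+ 2 = 3^-1 by rewrite ns max_nu_sqr.
have [a b c t0 im0] := nu_extremal _ Sx n2.
have s0 := max_nu_gt0; have s2 := max_nu_sqr.
(* The angles are the arguments of z1 and z2, both of modulus [s]. *)
have [|theta [ct st]] := @circle_param (coord7 1 x / s) (coord7 6 x / s).
  by rewrite !exprMn -mulrDl -/(zsq1 x) a exprVn s2 mulfV.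
have [|phi [cp sp]] := @circle_param (coord7 5 x / s) (coord7 2 x / s).
  by rewrite !exprMn -mulrDl addrC -/(zsq2 x) b exprVn s2 mulfV.
have sn0 : s != 0 by rewrite gt_eqF.
have e1 : coord7 1 x = cos theta * s by rewrite -ct divfK.
have e6 : coord7 6 x = sin theta * s by rewrite -st divfK.
have e5 : coord7 5 x = cos phi * s by rewrite -cp divfK.
have e2 : coord7 2 x = sin phi * s by rewrite -sp divfK.
exists theta, phi; apply: coord7P.
(* Here z1 z2 = s^2 e^(iw). Thus [Im_prod x = 0] and [nu x = s] give the imaginary and real parts of
   e^(iw) z3, namely 0 and [s]; multiplying by e^(-iw) recovers z3. *)
pose w := theta + phi; have h3 := cos2Dsin2 w.
have i0 : cos w * coord7 3 x + sin w * coord7 4 x = 0.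
  apply: (mulfI (expf_neq0 2 sn0)).
  move: im0; rewrite /Im_prod e1 e6 e5 e2 mulr0 => <-; rewrite /w cosD sinD; ring.
have r0 : cos w * coord7 4 x - sin w * coord7 3 x = s.
  have s3 : 3 * s ^+ 2 = 1 by rewrite s2; field.
  rewrite -[LHS]mul1r -s3; rewrite -{2}ns nuE e1 e6 e5 e2 /w cosD sinD; ring.
have e4 : coord7 4 x = cos w * s.
  rewrite -[LHS]mul1r -h3.
  transitivity (cos w * (cos w * coord7 4 x - sin w * coord7 3 x)
    + sin w * (cos w * coord7 3 x + sin w * coord7 4 x)); first by ring.
  by rewrite i0 r0 mulr0 addr0.
have e3 : coord7 3 x = - sin w * s.
  rewrite -[LHS]mul1r -h3.
  transitivity (cos w * (cos w * coord7 3 x + sin w * coord7 4 x)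
    - sin w * (cos w * coord7 4 x - sin w * coord7 3 x)); first by ring.
  by rewrite i0 r0 mulr0 sub0r mulNr.
by case=> [//|[|[|[|[|[|[|[|//]]]]]]]] _;
  rewrite !coord7_torus_act -/w !coord7_of_C3R /= ?(e1,e2,e3,e4,e5,e6,t0); ring.
Qed.

(** The antipodal map commutes with the linear action and reverses the sign of the cubic [nu], so
    the minimum is reduced to the maximum. *)
Lemma torus_actN (theta phi : R) x :
  torus_act theta phi (- x) = - torus_act theta phi x.
Proof.
apply: coord7P.
by case=> [//|[|[|[|[|[|[|[|//]]]]]]]] _; rewrite !(coord7N, coord7_torus_act); ring.
Qed.

Lemma torus_orbitN x : torus_orbit (- x) = [set y | torus_orbit x (- y)].
Proof.
apply/seteqP; split=> y [theta [phi e]]; exists theta, phi.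
  by rewrite e torus_actN opprK.
by rewrite torus_actN -e opprK.
Qed.

Lemma nuN x : nu (- x) = - nu x.
Proof. by rewrite -scaleN1r nuZ; ring. Qed.

Lemma S6N x : S6 (- x) <-> S6 x.
Proof.
rewrite /S6 /unit_sphere /= (_ : dot (- x) (- x) = dot x x)//.
by apply: eq_bigr => i _; rewrite !mxE mulrNN.
Qed.

Lemma torus_orbit_min : torus_orbit (- max_point) = [set x | S6 x /\ nu x = - s].
Proof.
rewrite torus_orbitN torus_orbit_max.
by apply/seteqP; split=> x /=; rewrite S6N nuN => -[Sx e]; split=> //; lra.
Qed.

Lemma torus_orbit_refl x : torus_orbit x x.
Proof.
exists 0, 0; apply: coord7P.
by case=> [//|[|[|[|[|[|[|[|//]]]]]]]] _;
  rewrite !coord7_torus_act ?addr0 ?cos0 ?sin0; ring.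
Qed.

Lemma nu_ge x : S6 x -> - s <= nu x.
Proof. by move=> Sx; rewrite lerNl -nuN nu_le// S6N. Qed.

End MultiMomentMapS6.

Theorem proposition3p3 (R : realType) :
  (exists S : 'I_3 -> set 'rV[R]_7,
     [/\ injective S,
         forall i, is_sphere 2 (S i) /\ S i `<=` S6,
         [set p | [/\ S6 p, nu p = 0 & critical p]] = \bigcup_i S i
       & exists a b : 'rV[R]_7,
           [/\ a <> b, \bigcap_i S i = [set a; b]
             & forall i j, i <> j -> S i `&` S j = [set a; b]]])
  /\
  (exists p q : 'rV[R]_7,
     [/\ S6 p, S6 q & torus_orbit p <> torus_orbit q]
     /\ [/\ forall x, torus_orbit p x \/ torus_orbit q x -> critical x,
            [set x | S6 x /\ forall y, S6 y -> nu y <= nu x] = torus_orbit p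
          & [set x | S6 x /\ forall y, S6 y -> nu x <= nu y] = torus_orbit q]).
Proof.
split.
  exists nu_sphere; split.
  - exact: nu_sphere_inj.
  - by move=> i; split; [exact: is_sphere_nu_sphere|move=> x []].
  - apply/seteqP; split=> x /=.
      move=> [Sx n0 cx].
      by have [i xi] := (nu_critical0 _ Sx).1 (conj n0 cx); exists i.
    move=> [i _ [Sx xi]].
    by have [n0 cx] := (nu_critical0 _ Sx).2 (ex_intro _ i xi); split.
  exists (pole 1), (pole (-1)); split.
  - by move=> /(congr1 (coord7 7)); rewrite !coord7_of_C3R; lra.
  - apply/seteqP; split=> x /=.
      move=> xS.
      (* The first and last spheres alone already meet only in the poles. *)
      suff : (nu_sphere ord0 `&` nu_sphere ord_max) x by rewrite nu_sphere_cap.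
      by split; exact: xS.
    by move=> [] -> i _; apply: nu_sphere_pole; rewrite ?sqrrN expr1n.
  exact: nu_sphere_cap.
pose P : 'rV[R]_7 := max_point.
have [Sp np] : S6 P /\ nu P = max_nu.
  suff : [set x | S6 x /\ nu x = max_nu] P by [].
  by rewrite -torus_orbit_max; exact: torus_orbit_refl.
have s0 := @max_nu_gt0 R.
exists P, (- P); split; split.
- exact: Sp.
- by rewrite S6N.
(* Equal orbits would force [max_nu] to equal its own negative at [P]. *)
- rewrite torus_orbit_max torus_orbit_min => e.
  have : [set x | S6 x /\ nu x = max_nu] P by split.
  by rewrite e /= np => -[_]; lra.
- move=> x; rewrite torus_orbit_max torus_orbit_min => -[] [Sx nx];
  by apply: nu_extremal_critical => //; rewrite nx ?sqrrN max_nu_sqr.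
- rewrite torus_orbit_max; apply/seteqP; split=> x /= [Sx nx]; split.
  + exact: Sx.
  (* A maximiser is at least as high as [P], where the bound is attained. *)
  + by apply/eqP; rewrite eq_le nu_le//= -np; exact: nx Sp.
  + exact: Sx.
  + by move=> y Sy; rewrite nx; exact: nu_le.
- rewrite torus_orbit_min; apply/seteqP; split=> x /= [Sx nx]; split.
  + exact: Sx.
  + apply/eqP; rewrite eq_le nu_ge// andbT -np -nuN.
    by apply: nx; rewrite S6N.
  + exact: Sx.
  + by move=> y Sy; rewrite nx; exact: nu_ge.
Qed.
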